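(* Let $n\ge 1$ be an integer. The $h$-complex $\Delta_n$ has a discrete Morse function with no critical cells of dimension $i$ for $i>(2n-5)/3$; that is, there is an acyclic matching on the face poset $F(\Delta_n)$ having no unmatched face of dimension $i$ whenever $i>(2n-5)/3$. Consequently $\tilde{H}_i(\Delta_n,\mathbb{Z})=0$ for all $i>(2n-5)/3$.
   Context: For an integer $n\ge 1$ let $B_n$ be the poset of all subsets of $[n]=\{1,\dots,n\}$ ordered by inclusion, and let $\hat{B}_n=B_n\setminus\{\emptyset,[n]\}$. For $\pi=\pi_1\cdots\pi_n\in S_n$ let $$\sigma_\pi=\{\{\pi_1,\dots,\pi_i\} : 1\le i\le n-1,\ \pi_i>\pi_{i+1}\},$$ a chain in $\hat{B}_n$. These are the minimal faces of the standard lexicographic shelling of the order complex $\Delta(\hat{B}_n)$, and $\Delta_n=\{\sigma_\pi : \pi\in S_n\}$ is a subcomplex of $\Delta(\hat{B}_n)$, called the $h$-complex of $\hat{B}_n$. The identity permutation gives the empty face, of dimension $-1$; in general $\dim\sigma_\pi$ is the number of descents of $\pi$ minus $1$. The face poset $F(\Delta)$ of a simplicial complex $\Delta$ is the set of faces, including the empty face, ordered by inclusion. A matching on $F(\Delta)$ is a set of pairwise disjoint pairs $\{\sigma,\tau\}$ with $\tau$ covering $\sigma$. It is acyclic if orienting the matching edges of the Hasse diagram upward (from smaller to larger face) and all other edges downward yields a directed graph without directed cycles. An acyclic matching gives a discrete Morse function whose critical cells are the unmatched faces. *)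

(* Defs.v *)
From HB Require Import structures.
From mathcomp Require Import all_boot all_order all_algebra.
From mathcomp Require Import perm boolp.

Set Implicit Arguments.
Unset Strict Implicit.
Unset Printing Implicit Defensive.

Import Order.TTheory GRing.Theory Num.Theory.

Local Open Scope ring_scope.

(* A finite simplicial complex with vertices in a finite type V is given by its
   set D of faces, the empty face included. The definitions below make sense
   for any family D; they have their usual meaning when D is closed under
   taking subsets. *)

Section FacePoset.
Variable V : finType.
Implicit Types (D : {set {set V}}) (s t r : {set V}).
Implicit Types M : {set {set V} * {set V}}.

Definition face_dim s : int := #|s|%:Z - 1.

Definition covers D s t : bool :=
  [&& s \in D, t \in D, s \proper t &
      ~~ [exists r in D, (s \proper r) && (r \proper t)]].

(* A matched pair is stored as (smaller face, larger face). *)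
Definition matching D M : Prop :=
  (forall p, p \in M -> covers D p.1 p.2) /\
  (forall p q, p \in M -> q \in M -> p != q ->
     [disjoint [set p.1; p.2] & [set q.1; q.2]]).

Definition morse_edge D M : rel {set V} :=
  fun s t => ((s, t) \in M) || (covers D t s && ((t, s) \notin M)).

Definition acyclic D M : Prop :=
  forall c : seq {set V}, c != [::] -> ~~ cycle (morse_edge D M) c.

Definition acyclic_matching D M : Prop := matching D M /\ acyclic D M.

Definition critical D M s : bool :=
  (s \in D) && [forall p in M, s \notin [set p.1; p.2]].

End FacePoset.

Section ReducedHomology.
Variable V : finType.
Implicit Types (D : {set {set V}}) (i : int) (c b : {ffun {set V} -> int}).

(* Simplices are oriented by the order in which [enum] lists the vertices.
   For s = {v_0, ..., v_k} in that order, the coefficient of s \ {v_j} in the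
   boundary of s is (-1)^j. In particular the boundary of a vertex is the empty
   face (the augmentation), and that of the empty face is 0. *)
Definition boundary c : {ffun {set V} -> int} :=
  [ffun t : {set V} => \sum_(s : {set V}) \sum_(v in s | s :\ v == t)
              (-1) ^+ index v (enum s) * c s].

Definition is_chain D i c : bool :=
  [forall s, (c s != 0) ==> (s \in D) && (face_dim s == i)].

Definition is_cycle D i : pred {ffun {set V} -> int} :=
  fun c => is_chain D i c && (boundary c == 0).

Lemma boundary_is_zmod_morphism : zmod_morphism boundary.
Proof.
move=> c b; apply/ffunP => t; rewrite !ffunE -sumrB; apply: eq_bigr => s _.
by rewrite -sumrB; apply: eq_bigr => v _; rewrite !ffunE mulrBr.
Qed.

HB.instance Definition _ :=
  GRing.isZmodMorphism.Build _ _ boundary boundary_is_zmod_morphism.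

Lemma is_chain0 D i : is_chain D i 0.
Proof. by apply/forallP => s; rewrite ffunE eqxx. Qed.

Lemma is_chainB D i c b :
  is_chain D i c -> is_chain D i b -> is_chain D i (c - b).
Proof.
move=> /forallP hc /forallP hb; apply/forallP => s; apply/implyP.
have [c0|cN0] := eqVneq (c s) 0; last by move: (hc s); rewrite cN0.
have [b0|bN0] := eqVneq (b s) 0; last by move: (hb s); rewrite bN0.
by rewrite !ffunE c0 b0 subr0 eqxx.
Qed.

Lemma is_cycle_zmod_closed D i : zmod_closed (is_cycle D i).
Proof.
split=> [|c b].
  by rewrite unfold_in /is_cycle is_chain0 raddf0 eqxx.
rewrite !unfold_in => /andP[hc /eqP dc] /andP[hb /eqP db].
by apply/andP; split; [exact: is_chainB | rewrite raddfB /= dc db subr0].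
Qed.

HB.instance Definition _ D i :=
  GRing.isZmodClosed.Build _ (is_cycle D i) (is_cycle_zmod_closed D i).

Record cycles D i :=
  Cycle { cycle_chain :> {ffun {set V} -> int}; _ : is_cycle D i cycle_chain }.

HB.instance Definition _ D i := [isSub for @cycle_chain D i].
HB.instance Definition _ D i := [Choice of cycles D i by <:].
HB.instance Definition _ D i := [SubChoice_isSubZmodule of cycles D i by <:].

Definition is_boundary D i : pred (cycles D i) :=
  fun z => `[< exists2 b, is_chain D (i + 1) b & boundary b = val z >].

Lemma is_boundary_zmod_closed D i : zmod_closed (@is_boundary D i).
Proof.
split=> [|x y].
  by apply/asboolP; exists 0; [exact: is_chain0 | rewrite !raddf0].
move=> /asboolP[b hb eb] /asboolP[c hc ec]; apply/asboolP.
by exists (b - c); [exact: is_chainB | rewrite !raddfB /= eb ec].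
Qed.

HB.instance Definition _ D i :=
  GRing.isZmodClosed.Build _ (@is_boundary D i) (@is_boundary_zmod_closed D i).

Definition boundaries D i : zmodClosed (cycles D i) :=
  GRing.ZmodClosed.clone _ (@is_boundary D i) _.

Definition reduced_homology D i : zmodType := Quotient.quot (boundaries D i).

End ReducedHomology.

Section HComplex.
Variable n : nat.
Implicit Types s : 'S_n.

(* Positions and values are numbered from 0, so position i : 'I_n is the
   (i+1)-st entry of the permutation; the last position is never a descent. *)
Definition descent s (i : 'I_n) : bool :=
  [exists j : 'I_n, (j == i.+1 :> nat) && (s j < s i)%N].

Definition prefix_set s (i : 'I_n) : {set 'I_n} :=
  [set s j | j : 'I_n & (j <= i)%N].

Definition sigma s : {set {set 'I_n}} :=
  [set prefix_set s i | i : 'I_n & descent s i].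

Definition h_complex : {set {set {set 'I_n}}} := [set sigma s | s : 'S_n].

End HComplex.

(* Main.v *)
Require Import Defs.
From mathcomp Require Import all_boot all_order all_algebra.
From mathcomp Require Import perm boolp zify ring.

Set Implicit Arguments.
Unset Strict Implicit.
Unset Printing Implicit Defensive.

Import Order.TTheory GRing.Theory Num.Theory.

(** The faces of the h-complex correspond to the ordered set partitions B_0 |
    ... | B_k of the ground set with min B_(i+1) < max B_i for all i: the
    vertices of the face are the proper partial unions of the blocks, the blocks
    are the ascending runs of the permutation, and removing a vertex merges two
    adjacent blocks ([h_complexP], [face_merges], [face_facet]). In particular
    the h-complex is closed under taking subsets.

    The matching exchanges {b} | C with the single block C + b, where b exceeds
    every element of C. A merge of this kind always gives a face, whereas b can
    be split off a block X only if b is smaller than the maximum of the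
    preceding block, if any, and the second largest element of X exceeds the
    minimum of the next block, if any. Blocks are scanned from left to right and
    the first admissible exchange is made. A merge at b may lower the minimum of
    its block so far that the block before it becomes splittable, and then the
    face obtained belongs to an earlier exchange. The scan therefore carries two
    numbers, [lo] and [hi], which forbid exactly the exchanges that would
    disturb earlier decisions. With this bookkeeping [toggle] is an involution
    ([toggle_spec]).

    Acyclicity comes from a potential with values in the lexicographically
    ordered sequences of numbers: if l is matched upwards with t, then l has the
    strictly smallest potential among the facets of t ([potential_increasing]),
    so the potential of the lower cells increases along every directed path that
    alternates between two dimensions ([acyclic_of_rank]).

    In an unmatched partition each singleton, except possibly a final one, can
    be charged injectively to a larger block: to the next block if the latter
    has a larger maximum, and otherwise to the preceding block, whose second
    largest element is what forbids the merge ([singles_critical]). So there are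
    at most as many singletons as larger blocks, plus one, which bounds the
    number k of descents by 2 (n - 1) / 3 ([critical_size]), that is, the
    dimension k - 1 by (2 n - 5) / 3.

    The homology statement follows from the standard argument of discrete Morse
    theory ([reduced_homology_eq0]): boundaries of upper cells are used to
    remove from a cycle all faces that are matched upwards, and a cycle
    supported on faces that are matched downwards is zero. *)

(** * Acyclic matchings from a potential on faces *)

Section Covers.
Variables (V : finType) (D : {set {set V}}).
Hypothesis Dcl : forall t v, t \in D -> t :\ v \in D.

(** Covering can be tested by deleting one vertex: a larger gap would contain an
    intermediate face, since [D] is closed under deletion. *)
Lemma coversP s t :
  reflect (t \in D /\ exists2 v, v \in t & s = t :\ v) (covers D s t).
Proof.
apply: (iffP and4P) => [[sD tD st nE]|[tD [v vt ->]]]; last first.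
  split=> //; [exact: Dcl | exact: properD1 |].
  apply/negP => /'exists_and3P[r [rD vr rt]].
  have := proper_card vr; have := proper_card rt.
  by have := cardsD1 v t; rewrite vt; lia.
split=> //; have [sst [v vt vs]] := properP st.
exists v => //; apply/eqP; apply: contraNT nE => neq.
apply/'exists_and3P; exists (t :\ v); split; [exact: Dcl | | exact: properD1].
by rewrite properEneq neq subsetD1 sst.
Qed.

Lemma covers_card s t : covers D s t -> #|t| = #|s|.+1.
Proof. by case/coversP=> _ [v vt ->]; rewrite (cardsD1 v t) vt. Qed.

End Covers.

Section RankAcyclic.
Variables (V : finType) (D : {set {set V}}) (M : {set {set V} * {set V}}).
Hypothesis Dcl : forall t v, t \in D -> t :\ v \in D.
Hypothesis matM : matching D M.

Lemma matching_lower_uniq s s' t : (s, t) \in M -> (s', t) \in M -> s = s'.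
Proof.
move=> h h'; case: (eqVneq (s, t) (s', t)) => [[]//|ne].
have /pred0P/(_ t) := matM.2 _ _ h h' ne.
by rewrite /= !inE eqxx !orbT.
Qed.

Lemma matching_upper_uniq s t t' : (s, t) \in M -> (s, t') \in M -> t = t'.
Proof.
move=> h h'; case: (eqVneq (s, t) (s, t')) => [[]//|ne].
have /pred0P/(_ s) := matM.2 _ _ h h' ne.
by rewrite /= !inE eqxx.
Qed.

Lemma matching_lower_not_upper r s t : (r, s) \in M -> (s, t) \notin M.
Proof.
move=> h; apply/negP => h'; case: (eqVneq (r, s) (s, t)) => [[e _]|ne].
  by have := covers_card Dcl (matM.1 _ h); rewrite /= e; lia.
have /pred0P/(_ s) := matM.2 _ _ h h' ne.
by rewrite /= !inE eqxx orbT.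
Qed.

Variables (d : Order.disp_t) (T : porderType d) (phi : {set V} -> T).

Let top (t : {set V}) := [exists s, (s, t) \in M].
Let base (t : {set V}) := odflt t [pick s | (s, t) \in M].
Let level (t : {set V}) := (#|t| - top t)%N.

Let topE s t : (s, t) \in M -> top t /\ base t = s.
Proof.
move=> h; split; first by apply/existsP; exists s.
rewrite /base; case: pickP => [s' h'|/(_ s)]; last by rewrite h.
exact: matching_lower_uniq h' h.
Qed.

Let ntopE t : ~~ top t -> base t = t.
Proof.
move=> h; rewrite /base; case: pickP => [s' h'|//].
by case/negP: h; apply/existsP; exists s'.
Qed.

(* Every directed edge is increasing for this strict order: first the level
   drops, then the potential of the lower cell grows, and the step from a lower
   cell to its upper cell comes last. *)
Let prec (x y : {set V}) : bool :=
  (level y < level x)%N || (level y == level x) &&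
  ((phi (base x) < phi (base y))%O ||
   (base x == base y) && (top x < top y)%N).

Let prec_trans : transitive prec.
Proof.
move=> y x z /orP[lxy|/andP[/eqP exy hxy]] /orP[lyz|/andP[/eqP eyz hyz]];
  rewrite /prec.
- by rewrite (ltn_trans lyz).
- by rewrite eyz lxy.
- by rewrite -exy lyz.
rewrite eyz exy eqxx; apply/orP; right => /=.
case/orP: hxy => [hxy|/andP[/eqP exy' hxy]];
  case/orP: hyz => [hyz|/andP[/eqP eyz' hyz]].
- by rewrite (lt_trans hxy).
- by rewrite -eyz' hxy.
- by rewrite exy' hyz.
- by rewrite exy' eyz' eqxx (ltn_trans hxy) ?orbT.
Qed.

Let prec_irr x : prec x x = false.
Proof. by rewrite /prec !ltnn ltxx !andbF. Qed.

(** Assign to a face the size of the lower cell of its pair, or its own size if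
    it is not an upper cell. This number never increases along an edge, so it is
    constant on a directed cycle, which thus alternates between lower and upper
    cells; there [phi] strictly increases from each lower cell to the next. *)
Lemma acyclic_of_rank :
  (forall s t s', (s, t) \in M -> covers D s' t -> s' != s ->
     (phi s < phi s')%O) ->
  acyclic D M.
Proof.
move=> hphi c cN0; apply/negP => hc.
have sub : subrel (morse_edge D M) prec.
  move=> x y /orP[xy|/andP[yx nyx]].
    have [ty by_] := topE xy.
    have ntx : ~~ top x.
      apply/existsP => -[r rx]; move/negP: (matching_lower_not_upper y rx).
      exact.
    have := covers_card Dcl (matM.1 _ xy); rewrite /= => cxy.
    rewrite /prec /level ty (negbTE ntx) cxy by_ (ntopE ntx) eqxx /=.
    by apply/orP; right; lia.
  have cyx := covers_card Dcl yx.
  rewrite /prec /level; case: (boolP (top x)) => [tx|ntx] /=; last first.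
    by apply/orP; left; case: (top y); lia.
  case: (boolP (top y)) => [ty|nty] /=.
    have : (0 < #|y|)%N.
      case/existsP: ty => s sy.
      by rewrite (covers_card Dcl (matM.1 _ sy)).
    by move=> ?; apply/orP; left; lia.
  case/existsP: tx => s sx; have [_ bx] := topE sx.
  rewrite bx (ntopE nty) (hphi s x y) //; first by apply/orP; right; lia.
  by apply: contraNneq nyx => ->.
case: c cN0 hc => [//|x p] _ /= hp.
have := order_path_min prec_trans (sub_path sub hp).
by rewrite all_rcons prec_irr.
Qed.

End RankAcyclic.

(** * Homology in dimensions without critical faces *)

Section BoundarySquare.
Local Open Scope ring_scope.
Variable V : finType.
Implicit Types (s t u : {set V}) (v w : V).

Definition before w v : bool := (index w (enum V) < index v (enum V))%N.

Lemma index_filter (T : eqType) (p : pred T) (q : seq T) x :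
  p x -> x \in q -> index x (filter p q) = count p (take (index x q) q).
Proof.
move=> px; elim: q => //= y q IHq; rewrite inE [y == x]eq_sym.
have [<-|neq] /= := eqVneq x y; first by rewrite px /= eqxx.
by move=> /IHq <-; case: (p y) => //=; rewrite eq_sym (negbTE neq).
Qed.

(** Deleting [w] shifts the position of exactly those vertices that come after
    it, which is what makes the two signs below opposite. *)
Lemma index_enumD1 s v w : v \in s -> w \in s -> v != w ->
  index v (enum s) = (index v (enum (s :\ w)) + before w v)%N.
Proof.
move=> vs ws vw; rewrite /before enumT {1 2}/enum_mem.
set q := Finite.enum V.
have inq x : x \in q by rewrite /q -enumT mem_enum.
rewrite !index_filter //=; last by rewrite !inE vw.
rewrite -in_take // -count_uniq_mem;
  last by rewrite take_uniq // /q -enumT enum_uniq.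
rewrite -count_predUI [X in (_ + X)%N](@eq_count _ _ pred0) => [|x] /=.
  rewrite count_pred0 addn0; apply: eq_count => x /=; rewrite !inE.
  by case: eqP => [->|_]; rewrite ?ws ?orbF.
by rewrite !inE; case: (x =P w) => _; rewrite ?andbF.
Qed.

Lemma before_sym v w : v != w -> before w v = ~~ before v w.
Proof.
rewrite /before -leqNgt [RHS]leq_eqVlt => vw.
case: eqP => [e|//]; case/eqP: vw.
by rewrite -[v](nth_index v (mem_enum V v)) -[w](nth_index v (mem_enum V w)) e.
Qed.

Definition bsign s v : int := (-1) ^+ index v (enum s).

Lemma bsign_anti s v w : v \in s -> w \in s -> v != w ->
  bsign s v * bsign (s :\ v) w = - (bsign s w * bsign (s :\ w) v).
Proof.
move=> vs ws vw; rewrite /bsign (index_enumD1 vs ws vw).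
rewrite (index_enumD1 ws vs) 1?eq_sym // (before_sym vw) !exprD.
by case: (before v w); rewrite /= expr0 expr1; ring.
Qed.

Lemma boundaryE (c : {ffun {set V} -> int}) t :
  boundary c t = \sum_(s : {set V}) \sum_(v in s | s :\ v == t) bsign s v * c s.
Proof. by rewrite ffunE. Qed.

(** The terms obtained by removing two vertices in either order cancel, so each
    inner sum [g s] is its own opposite. *)
Lemma boundary_boundary (c : {ffun {set V} -> int}) :
  boundary (boundary c) = 0.
Proof.
apply/ffunP => u; rewrite boundaryE ffunE.
pose f (s : {set V}) v w : int := bsign s v * bsign (s :\ v) w.
pose g (s : {set V}) : int := \sum_(v in s) \sum_(w in s | (v != w) &&
  (s :\ v :\ w == u)) f s v w.
have g0 s : g s = 0.
  suff: g s = - g s by lia.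
  rewrite /g [LHS](exchange_big_dep (mem s)) /=; last by move=> ? ? _ /andP[].
  rewrite -sumrN; apply: eq_bigr => v vs.
  rewrite -sumrN; apply: eq_big => [w|w /and4P[ws _ wv _]].
    by rewrite vs [w == v]eq_sym setDDl setUC -setDDl.
  by rewrite /f bsign_anti // eq_sym.
transitivity (\sum_(s : {set V}) g s * c s); last by apply: big1 => s _;
  rewrite g0 mul0r.
rewrite (eq_bigr (fun t => \sum_(s : {set V}) \sum_(v in s | s :\ v == t)
    \sum_(w in t | t :\ w == u) bsign s v * bsign t w * c s)); last first.
  move=> t _; transitivity (\sum_(w in t | t :\ w == u)
      \sum_(s : {set V}) \sum_(v in s | s :\ v == t) bsign s v * bsign t w * c
        s).
    apply: eq_bigr => w _; rewrite boundaryE mulr_sumr; apply: eq_bigr => s _.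
    by rewrite mulr_sumr; apply: eq_bigr => v _; ring.
  by rewrite exchange_big; apply: eq_bigr => s _; exact: exchange_big.
rewrite exchange_big; apply: eq_bigr => s _.
rewrite (exchange_big_dep (mem s)) /=; last by move=> ? ? _ /andP[].
rewrite /g [RHS]mulr_suml; apply: eq_bigr => v vs.
rewrite (bigD1 (s :\ v)) /= ?vs ?eqxx // [X in _ + X]big1 ?addr0; last first.
  by move=> t /andP[/andP[_ /eqP ->]]; rewrite eqxx.
rewrite mulr_suml; apply: eq_big => [w|w _]; last by [].
by rewrite !inE [w == v]eq_sym; case: (w \in s); rewrite ?andbF ?andbT.
Qed.
End BoundarySquare.

Section Incidence.
Local Open Scope ring_scope.
Variable V : finType.
Implicit Types (s t u : {set V}) (v w : V).

(** The sum has at most one term, the sign of [s] in the boundary of [t]. *)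
Definition incidence t s : int := \sum_(v in t | t :\ v == s) bsign t v.

Lemma boundary_incidence (c : {ffun {set V} -> int}) s :
  boundary c s = \sum_t incidence t s * c t.
Proof. by rewrite boundaryE; apply: eq_bigr => t _;
  rewrite /incidence mulr_suml. Qed.

Lemma incidence_facet t v : v \in t -> incidence t (t :\ v) = bsign t v.
Proof.
move=> vt; rewrite /incidence (bigD1 v) ?vt ?eqxx //= big1 ?addr0 // => w.
move=> /andP[/andP[wt /eqP e] wv].
by move/setP/(_ w): e; rewrite !inE eqxx wt wv.
Qed.

Lemma incidence_sqr t v : v \in t -> incidence t (t :\ v) ^+ 2 = 1.
Proof. by move=> vt; rewrite incidence_facet // /bsign sqrr_sign. Qed.

Lemma incidence_neq0 t s : incidence t s != 0 -> exists2 v,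
  v \in t & s = t :\ v.
Proof.
case: (boolP [exists v in t, t :\ v == s]) => [/'exists_andP[v [vt /eqP <-]]|].
  by exists v.
move=> /'exists_andP nex /eqP[]; apply: big1 => v /andP[vt e].
by case: nex; exists v.
Qed.

End Incidence.

Section MorseVanishing.
Local Open Scope ring_scope.
Variables (V : finType) (D : {set {set V}}) (M : {set {set V} * {set V}}).
Hypothesis Dcl : forall t v, t \in D -> t :\ v \in D.
Hypothesis acM : acyclic_matching D M.

Let covM s t : (s, t) \in M -> covers D s t := fun h => acM.1.1 (s, t) h.

(** In a finite acyclic graph the number of reachable vertices drops along every
    edge. *)
Lemma morse_rank :
  exists r : {set V} -> nat, forall x y, morse_edge D M x y -> (r y < r x)%N.
Proof.
pose e := morse_edge D M.
exists (fun x => #|[pred z | connect e x z]|) => x y exy.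
apply/proper_card/properP; split.
  by apply/subsetP => z; rewrite !inE; apply/connect_trans/connect1.
exists x; rewrite !inE //; apply/negP => /connectP[p hp xp].
by have /negP[] := acM.2 (y :: p) isT; rewrite /= rcons_path hp -xp.
Qed.

Lemma incidence_matched s t : (s, t) \in M -> incidence t s * incidence t s = 1.
Proof.
by move=> st; have /(coversP Dcl)[_ [v vt ->]] := covM st; exact: incidence_sqr.
Qed.

Lemma is_chain_support i c s : is_chain D i c -> c s != 0 ->
  s \in D /\ face_dim s = i.
Proof. by move=> /forallP/(_ s)/implyP h /h /andP[? /eqP]. Qed.

Lemma boundary_chain i c : is_chain D (i + 1) c -> is_chain D i (boundary c).
Proof.
move=> hc; apply/forallP => s; apply/implyP; rewrite boundary_incidence => nz.
have [t nzt] : exists t, incidence t s * c t != 0.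
  apply/existsP; apply: contraNT nz; rewrite negb_exists => /forallP h.
  by apply/eqP/big1 => t _; move: (h t); rewrite negbK => /eqP.
have [v vt st] : exists2 v, v \in t & s = t :\ v.
  by apply: incidence_neq0; apply: contraNneq nzt => ->; rewrite mul0r.
have [tD dt] : t \in D /\ face_dim t = i + 1.
  by apply: (is_chain_support hc); apply: contraNneq nzt => ->; rewrite mulr0.
rewrite st Dcl //=; move: dt; rewrite /face_dim (cardsD1 v t) vt.
by move=> ?; apply/eqP; lia.
Qed.

(** Adding boundaries of upper cells of matched pairs clears the lower ones, in
    decreasing order of rank: the other facets of such an upper cell have
    smaller rank, so nothing already cleared is disturbed. *)
Lemma clear_lower_cells i c : is_chain D i c ->
  exists2 b, is_chain D (i + 1) b &
    forall s t, (s, t) \in M -> c s = boundary b s.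
Proof.
move=> hc; have [r hr] := morse_rank.
pose B := (\max_s r s).+1.
suff H k : exists2 b, is_chain D (i + 1) b &
    forall s t, (s, t) \in M -> (B <= r s + k)%N -> c s = boundary b s.
  have [b hb h] := H B; exists b => // s t /h; apply; exact: leq_addl.
elim: k => [|k [b hb IH]].
  exists 0; first exact: is_chain0.
  by move=> s t _; rewrite addn0 leqNgt ltnS leq_bigmax.
pose c' := c - boundary b.
have hc' : is_chain D i c' by apply: is_chainB; rewrite ?boundary_chain.
pose lower t s := ((s, t) \in M) && (r s + k.+1 == B)%N.
pose b' : {ffun {set V} -> int} := [ffun t =>
  if [pick s | lower t s] is Some s then incidence t s * c' s else 0].
have b'E s t : (s, t) \in M -> (r s + k.+1 = B)%N ->
  b' t = incidence t s * c' s.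
  move=> st rs; rewrite ffunE; case: pickP => [s' /andP[s't _]|/(_ s)].
    by rewrite (matching_lower_uniq acM.1 s't st).
  by rewrite /lower st rs eqxx.
have b'N t : b' t != 0 -> exists2 s, lower t s & c' s != 0.
  rewrite ffunE; case: pickP => [s ls nz|]; last by rewrite eqxx.
  by exists s => //; apply: contraNneq nz => ->; rewrite mulr0.
have hb' : is_chain D (i + 1) b'.
  apply/forallP => t; apply/implyP => /b'N[s /andP[st _] /(is_chain_support
    hc')].
  have cst := covM st; case=> _ ds.
  rewrite -ds /face_dim (covers_card Dcl cst).
  by case/and4P: cst => _ -> _ _; apply/eqP; lia.
exists (b + b'); first by rewrite -[b']opprK is_chainB // -sub0r is_chainB //
  is_chain0.
move=> s t st rs; rewrite raddfD /= [RHS]ffunE.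
rewrite [X in _ = _ + X]boundary_incidence.
have other u : u != t \/ (B <= r s + k)%N -> incidence u s * b' u = 0.
  move=> hu; apply/eqP; apply: contraT; rewrite mulf_eq0 negb_or => /andP[].
  move=> /incidence_neq0[v vu su] /b'N[s' /andP[s'u /eqP rs'] _].
  have ss' : s != s'.
    apply/negP => /eqP e; case: hu => [|]; last by rewrite e; lia.
    by rewrite (matching_upper_uniq acM.1 (_ : (s, u) \in M) st) ?eqxx // e.
  have su' : morse_edge D M u s.
    apply/orP; right; apply/andP; split.
      by apply/(coversP Dcl); split; [case/and4P: (covM s'u) | exists v].
    by apply: contra ss' => /(matching_lower_uniq acM.1) -/(_ _ s'u) ->.
  have s'u' : morse_edge D M s' u by rewrite /morse_edge s'u.
  by have := hr _ _ su'; have := hr _ _ s'u'; lia.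
have [rs'|rs'] := leqP B (r s + k)%N.
  by rewrite (IH _ _ st rs') big1 ?addr0 // => u _; apply: other; right.
rewrite (bigD1 t) //= big1 ?addr0 => [|u ut]; last by apply: other; left.
rewrite (b'E s) //; last by lia.
by rewrite mulrA incidence_matched // mul1r /c' !ffunE addrC subrK.
Qed.

(** If every face in the support is matched downwards, the lower partner of a
    face of maximal rank lies in no other face of the support. *)
Lemma cycle_without_lower_cells i c : is_cycle D i c ->
  (forall s, critical D M s -> face_dim s <> i) ->
  (forall s t, (s, t) \in M -> c s = 0) -> c = 0.
Proof.
move=> /andP[hc /eqP dc] ncrit low; have [r hr] := morse_rank.
apply/eqP; apply: contraT => cN0.
have [s0 s0N] : exists s, c s != 0.
  apply/existsP; apply: contraNT cN0; rewrite negb_exists => /forallP h.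
  by apply/eqP/ffunP => s; rewrite ffunE; move: (h s); rewrite negbK => /eqP.
case: (@arg_maxnP _ s0 (fun s => c s != 0) r s0N) => s sN smax.
have [sD ds] := is_chain_support hc sN.
have [p ps] : exists p, (p, s) \in M.
  have : ~~ critical D M s by apply/negP => /ncrit.
  rewrite /critical sD negb_forall => /existsP[[p q]].
  rewrite negb_imply negbK !inE /= => /andP[pq /orP[]/eqP e]; last by exists p;
    rewrite e.
  by move: sN; rewrite (low s q) ?eqxx // e.
have := congr1 (fun f : {ffun _ -> int} => f p) dc.
rewrite boundary_incidence ffunE (bigD1 s) //= big1 ?addr0 => [/eqP|t ts].
  rewrite mulf_eq0 (negbTE sN) orbF => /eqP e.
  by have := incidence_matched ps; rewrite e.
apply/eqP; apply: contraT; rewrite mulf_eq0 negb_or => /andP[].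
move=> /incidence_neq0[v vt pt] tN; have [tD _] := is_chain_support hc tN.
have tp : morse_edge D M t p.
  apply/orP; right; apply/andP; split; first by apply/(coversP Dcl);
    split=> //; exists v.
  by apply: contra ts => /(matching_upper_uniq acM.1) -/(_ _ ps) ->.
have ps' : morse_edge D M p s by rewrite /morse_edge ps.
by have := hr _ _ tp; have := hr _ _ ps'; have := smax t tN; lia.
Qed.

Lemma reduced_homology_eq0 i :
  (forall s, critical D M s -> face_dim s <> i) ->
  forall x : reduced_homology D i, x = 0.
Proof.
move=> ncrit x; rewrite -[x]reprK; set z := repr x.
have zb : z \in boundaries D i.
  have [zc zd] : is_chain D i (val z) /\ boundary (val z) = 0.
    by case: z => z /= /andP[? /eqP].
  have [b hb low] := clear_lower_cells zc.
  apply/asboolP; exists b => //; apply/eqP; rewrite -subr_eq0 -opprB oppr_eq0.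
  apply/eqP; apply: (@cycle_without_lower_cells i) => //.
    rewrite /is_cycle is_chainB ?boundary_chain //=.
    by rewrite raddfB /= zd boundary_boundary subr0.
  by move=> s t st; rewrite ffunE (low s t st) [X in _ + X]ffunE subrr.
rewrite -[RHS](raddf0 (\pi_(reduced_homology D i))%qT).
by apply/eqP; rewrite -Quotient.idealrBE subr0.
Qed.

End MorseVanishing.

(** * Extreme elements of blocks *)

Section OrderedPartitions.
Variable n : nat.
Implicit Types (A B C X : {set 'I_n}) (x y : 'I_n) (lo hi : nat).
Implicit Types (l t m : seq {set 'I_n}) (w : seq 'I_n) (E : {set {set 'I_n}}).

(** Extreme elements are counted from 1, so that the value 0 is free: it is the
    maximum of the empty set and, later, the first minimum of an empty list. *)
Definition bmax B := \max_(x in B) x.+1.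
Definition bmin B := n.+1 - \max_(x in B) (n - x).

Lemma bmax_leP B (k : nat) : reflect (forall x, x \in B -> x < k) (bmax B <= k).
Proof. exact: bigmax_leqP. Qed.

Lemma bmin_geP B (k : nat) : k <= n.+1 ->
  reflect (forall x, x \in B -> k <= x.+1) (k <= bmin B).
Proof.
move=> kn; have -> : (k <= bmin B) = (\max_(x in B) (n - x) <= n.+1 - k).
  have : \max_(x in B) (n - x) <= n by apply/bigmax_leqP => x _;
    exact: leq_subr.
  by rewrite /bmin; lia.
apply: (iffP (bigmax_leqP _ _ _)) => h x /h; have := ltn_ord x; lia.
Qed.

Lemma mem_bmax B x : x \in B -> x < bmax B.
Proof. by move: x; exact/bmax_leP. Qed.

Lemma mem_bmin B x : x \in B -> bmin B <= x.+1.
Proof. by move: x; apply/bmin_geP; [exact: leq_subr|]. Qed.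

Lemma bmax_mem B : B != set0 -> exists2 x, x \in B & bmax B = x.+1.
Proof.
rewrite -card_gt0 => /(@eq_bigmax_cond _ _ (fun x : 'I_n => x.+1))[x xB e].
by exists x.
Qed.

Lemma bmin_mem B : B != set0 -> exists2 x, x \in B & bmin B = x.+1.
Proof.
rewrite -card_gt0 => /(@eq_bigmax_cond _ _ (fun x : 'I_n => n - x))[x xB e].
by exists x => //; rewrite /bmin e; have := ltn_ord x; lia.
Qed.

Lemma bmax0 : bmax set0 = 0. Proof. by rewrite /bmax big_set0. Qed.

Lemma bmax_gt0 B : B != set0 -> 0 < bmax B.
Proof. by case/bmax_mem => x _ ->. Qed.

Lemma bmin_gt0 B : 0 < bmin B.
Proof. exact/bmin_geP. Qed.

Lemma bmin_le_bmax B : B != set0 -> bmin B <= bmax B.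
Proof. by case/set0Pn => x xB; exact: leq_trans (mem_bmin xB) (mem_bmax xB).
Qed.

Lemma bmax_le_n B : bmax B <= n.
Proof. by apply/bmax_leP => x _. Qed.

Lemma bmaxU B C : bmax (B :|: C) = maxn (bmax B) (bmax C).
Proof.
apply/eqP; rewrite eqn_leq geq_max; apply/and3P; split.
- by apply/bmax_leP => x; rewrite inE leq_max => /orP[]/mem_bmax ->;
  rewrite ?orbT.
- by apply/bmax_leP => x xB; apply: mem_bmax; rewrite inE xB.
- by apply/bmax_leP => x xC; apply: mem_bmax; rewrite inE xC orbT.
Qed.

Lemma bminU B C : bmin (B :|: C) = minn (bmin B) (bmin C).
Proof.
apply/eqP; rewrite eqn_leq leq_min; apply/andP; split.
  apply/andP; split; (apply/bmin_geP; first exact: leq_subr) => x xB.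
    by apply: mem_bmin; rewrite inE xB.
  by apply: mem_bmin; rewrite inE xB orbT.
apply/bmin_geP => [|x]; first by rewrite geq_min leq_subr.
by rewrite inE geq_min => /orP[]/mem_bmin ->; rewrite ?orbT.
Qed.

(** Splitting off the maximum: [rest B] is empty exactly when a nonempty [B] is
    a singleton, and [bmax (rest B)] is then 0; otherwise the latter is the
    second largest element of [B]. *)
Definition topmost B := [set x in B | x.+1 == bmax B].
Definition rest B := [set x in B | x.+1 != bmax B].

Lemma topmost_neq0 B : B != set0 -> topmost B != set0.
Proof.
by case/bmax_mem => x xB e; apply/set0Pn; exists x; rewrite inE xB e eqxx.
Qed.

Lemma setU_topmost_rest B : topmost B :|: rest B = B.
Proof. by apply/setP => x; rewrite !inE -andb_orr orbN andbT. Qed.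

Lemma topmost_disjoint B : [disjoint topmost B & rest B].
Proof. by apply/pred0P => x; rewrite /= !inE; case: eqP; rewrite ?andbF. Qed.

Lemma bmax_topmost B : B != set0 -> bmax (topmost B) = bmax B.
Proof.
by move=> /topmost_neq0/bmax_mem[x]; rewrite inE => /andP[_ /eqP <-] ->.
Qed.

Lemma bmin_topmost B : B != set0 -> bmin (topmost B) = bmax B.
Proof.
by move=> /topmost_neq0/bmin_mem[x]; rewrite inE => /andP[_ /eqP <-] ->.
Qed.

Lemma rest_topmost B : B != set0 -> rest (topmost B) = set0.
Proof.
move=> B0; apply/setP => x; rewrite !inE bmax_topmost //.
by case: eqP; rewrite ?andbF.
Qed.

Lemma bmax_rest B : B != set0 -> bmax (rest B) < bmax B.
Proof.
move=> B0; case: (eqVneq (rest B) set0) => [->|/bmax_mem[x]].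
  by rewrite bmax0 bmax_gt0.
by rewrite inE => /andP[xB ne] ->; rewrite ltn_neqAle ne mem_bmax.
Qed.

Lemma rest0_bmin B : B != set0 -> rest B = set0 -> bmin B = bmax B.
Proof. by move=> B0 r0; rewrite -{1}[B]setU_topmost_rest r0 setU0 bmin_topmost.
Qed.

Lemma bmin_rest B : B != set0 -> rest B != set0 -> bmin (rest B) = bmin B.
Proof.
move=> B0 r0; rewrite -[in RHS](setU_topmost_rest B) bminU bmin_topmost //.
by have := bmin_le_bmax r0; have := bmax_rest B0; lia.
Qed.

Lemma rest_neq0_bmin B : B != set0 -> rest B != set0 -> bmin B < bmax B.
Proof.
move=> B0 r0; rewrite -(bmin_rest B0 r0).
exact: leq_ltn_trans (bmin_le_bmax r0) (bmax_rest B0).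
Qed.

(** Merging {b} with a block of smaller elements is undone by splitting off the
    maximum. *)
Lemma rest_merge B C : B != set0 -> rest B = set0 -> bmax C < bmax B ->
  rest (B :|: C) = C /\ topmost (B :|: C) = B.
Proof.
move=> B0 r0 lt; have e : bmax (B :|: C) = bmax B by rewrite bmaxU; lia.
have hB x : x \in B -> x.+1 == bmax B.
  by move=> xB; move/setP/(_ x): r0; rewrite !inE xB => /negbFE.
have hC x : x \in C -> (x.+1 == bmax B) = false by move/mem_bmax; lia.
split; apply/setP => x; rewrite !inE e;
  have [xC|xC] := boolP (x \in C); have [xB|xB] := boolP (x \in B);
  rewrite /= ?(hC x xC) ?(hB x xB) //.
by have := hB x xB; rewrite hC.
Qed.

Lemma bmax_disjoint B C : B != set0 -> C != set0 -> [disjoint B & C] ->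
  bmax B != bmax C.
Proof.
move=> /bmax_mem[x xB ->] /bmax_mem[y yC ->] dBC; apply/eqP => -[] /val_inj e.
by move/pred0P/(_ x): dBC; rewrite /= xB e yC.
Qed.

(** * The toggling involution *)

Definition first_max l := if l is C :: _ then bmax C else 0.
Definition first_min l := if l is C :: _ then bmin C else 0.

(** The bound [lo] protects the block before [B]: it is the second largest
    element of that block when only the condition on the next minimum prevents
    the block from being split, and a merge producing a block with an element
    below [lo] would make it splittable. *)
Definition mergeable lo B l :=
  [&& rest B == set0, l != [::], first_max l < bmax B & lo <= first_min l].

(** The maximum of a block can be split off when it is below [hi] and the
    remaining elements still descend to the next block. Normally [hi] is the
    maximum of the preceding block. *)
Definition splittable hi B l :=
  [&& rest B != set0, bmax B < hi & first_min l < bmax (rest B)].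

Definition next_lo hi B :=
  if (rest B != set0) && (bmax B < hi) then bmax (rest B) else 0.

(** After a singleton {b} that is followed by a larger maximum, splitting is
    impossible and [hi] is 0. After a singleton whose merge was forbidden by
    [lo], splitting off a maximum above [lo] would raise the next minimum above
    [lo] and permit that merge, so the new bound is [lo]. *)
Definition next_hi lo B l :=
  if rest B != set0 then bmax B else if first_max l < bmax B then lo else 0.

Fixpoint toggle lo hi l :=
  if l is B :: l1 then
    if mergeable lo B l1 then Some ((B :|: head set0 l1) :: behead l1)
    else if splittable hi B l1 then Some (topmost B :: rest B :: l1)
    else omap (cons B) (toggle (next_lo hi B) (next_hi lo B l1) l1)
  else None.

Arguments toggle : simpl never.

Lemma toggle_cons lo hi B l : toggle lo hi (B :: l) =
  if mergeable lo B l then Some ((B :|: head set0 l) :: behead l)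
  else if splittable hi B l then Some (topmost B :: rest B :: l)
  else omap (cons B) (toggle (next_lo hi B) (next_hi lo B l) l).
Proof. by []. Qed.

(** What the scan knows about the first of the remaining blocks. When [hi] is 0
    that block has elements on both sides of the preceding singleton, so it has
    at least two elements. *)
Definition admissible lo hi l :=
  if l is B :: _ then
    (lo <= bmin B) && (if hi == 0 then bmin B < bmax B else bmin B < hi)
  else true.

Definition nonempty l := all (fun B => B != set0) l.
Definition descending l := sorted (fun B C => bmin C < bmax B) l.

Arguments nonempty : simpl never.
Arguments descending : simpl never.

Lemma nonempty_cons B l : nonempty (B :: l) = (B != set0) && nonempty l.
Proof. by []. Qed.

Lemma descending_cons B l :
  descending (B :: l) = ((l == [::]) || (first_min l < bmax B)) && descending l.
Proof. by case: l. Qed.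

Lemma admissible_next lo hi B l : nonempty (B :: l) -> descending (B :: l) ->
  admissible lo hi (B :: l) -> ~~ mergeable lo B l -> ~~ splittable hi B l ->
  admissible (next_lo hi B) (next_hi lo B l) l.
Proof.
case: l => [//|C l] /and3P[B0 C0 _] /andP[dBC _] /= /andP[loB hiB].
rewrite /mergeable /splittable /next_lo /next_hi /=.
case: (eqVneq (rest B) set0) => [r0|r0] /=; have := bmin_le_bmax C0;
  have := bmin_gt0 C.
  by have := rest0_bmin B0 r0; move: hiB; do ?case: ifP; lia.
by have := bmax_rest B0; have := bmax_gt0 r0; move: hiB; do ?case: ifP; lia.
Qed.

(** The exchange at one place does not change the decisions made before it: it
    keeps the maximum of the block where it occurs, and [lo] and [hi] are such
    that the minimum stays on the same side of every bound used earlier. *)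
Lemma toggle_spec lo hi l l' :
  nonempty l -> descending l -> admissible lo hi l ->
  toggle lo hi l = Some l' ->
  [/\ nonempty l', descending l', admissible lo hi l',
      toggle lo hi l' = Some l &
      [/\ l' != [::], first_max l' = first_max l &
          hi = 0 -> first_min l' = first_min l]].
Proof.
elim: l lo hi l' => [//|B l IHl] lo hi l' nel del adm.
have adn := admissible_next nel del adm.
have [B0 nel'] : B != set0 /\ nonempty l by apply/andP.
have del' : descending l.
  by move: del; rewrite descending_cons => /andP[].
move: adm => /= /andP[a1 a2]; have mB := rest0_bmin B0.
rewrite toggle_cons; case: ifPn => [/and4P[/eqP r0 lN0 lt le] [<-]|nmg].
  case: l lN0 lt le {IHl adn} nel del nel' del' => //= C l _ mxlt lo_le.
  rewrite descending_cons [nonempty (C :: l)]nonempty_cons /= => _ /andP[dBC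
    dl] /andP[C0 nel] _.
  have [rU tU] := rest_merge B0 r0 mxlt.
  have mxUE : bmax (B :|: C) = bmax B by rewrite bmaxU; lia.
  have mBC := bmin_le_bmax C0; have mB' := mB r0.
  have mnUE : bmin (B :|: C) = bmin C by rewrite bminU; lia.
  have a3 : bmax B < hi by move: a2; case: eqP; lia.
  split=> //=.
  - by rewrite nonempty_cons nel andbT setU_eq0 negb_and B0.
  - have := dl; rewrite !descending_cons mxUE => /andP[h ->]; rewrite andbT.
    by case/orP: h => [->//|h]; apply/orP; right; lia.
  - by rewrite mnUE mxUE; case: eqP => ?; lia.
  - rewrite toggle_cons /mergeable rU (negbTE C0) /= /splittable rU C0 mxUE a3
    tU /=.
    case: l dl {nel} => [|E l] /=; first by rewrite bmax_gt0.
    by rewrite descending_cons => /andP[/= -> _].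
  - by split=> //; lia.
case: ifPn => [/and3P[r0 lt le] [<-]|nsp].
  split=> //=.
  - by rewrite !nonempty_cons topmost_neq0 // r0.
  - rewrite !descending_cons /= bmax_topmost // bmin_rest // rest_neq0_bmin //.
    by rewrite del' le orbT.
  - by rewrite bmin_topmost // bmax_topmost //; have := rest_neq0_bmin B0 r0;
    case: eqP; lia.
  - rewrite toggle_cons /mergeable rest_topmost // eqxx /= bmax_topmost //
    bmax_rest // bmin_rest // a1.
    by rewrite setU_topmost_rest.
  - by split=> //; [rewrite bmax_topmost | lia].
case E: toggle => [l1|//] [<-].
have [nel1 del1 adm1 tog1 [l10 mx1 mn1]] := IHl _ _ _ nel' del' (adn nmg nsp) E.
have lN0 : l != [::] by case: (l) E.
have nhE : next_hi lo B l1 = next_hi lo B l by rewrite /next_hi mx1.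
have dBl : first_min l < bmax B.
  by move: del; rewrite descending_cons (negbTE lN0) => /andP[].
case: l1 l10 nel1 del1 adm1 mx1 mn1 tog1 nhE E => [//|C1 l1] _ nel1 del1.
rewrite /admissible => /andP[b1 b2] mx1 mn1 tog1 nhE E.
have gt0 := bmin_gt0 C1; rewrite /= in mx1 mn1.
move: nmg nsp b1 b2 mn1 nhE tog1; rewrite /mergeable /splittable /next_lo.
rewrite /next_hi lN0 /=; case: (eqVneq (rest B) set0) => [r0|r0] /=.
  have mB' := mB r0; rewrite mx1.
  move=> nmg _ b1 b2 mn1 _ tog1.
  have [mnl1 unmg] : bmin C1 < bmax B /\ (first_max l < bmax B) &&
    (lo <= bmin C1) = false.
    clear -nmg b2 mn1 a1 mB' dBl;
      case: (ltnP (first_max l) (bmax B)) nmg b2 mn1 => /= h.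
      by move=> nmg b2 _; move: b2; case: eqP; lia.
    by move=> _ _ ->.
  split; [by rewrite nonempty_cons B0 | by rewrite descending_cons /= mnl1 |
    exact/andP | | by split].
  rewrite toggle_cons /mergeable /splittable /next_lo /next_hi r0 eqxx /=.
  by rewrite mx1 unmg tog1.
move=> _ nsp b1 b2 _ _ tog1; have gt0' := bmax_gt0 r0.
have mnl1 : bmin C1 < bmax B by have := bmax_rest B0; clear -b2 gt0'; move: b2;
  case: eqP; lia.
split; [by rewrite nonempty_cons B0 | by rewrite descending_cons /= mnl1 |
    exact/andP | | by split].
rewrite toggle_cons /mergeable /splittable /next_lo /next_hi r0 /=.
rewrite (negbTE r0) /= tog1 ifF //.
by clear -nsp b1; move: nsp b1; case: ltnP => /= _; lia.
Qed.

(** * Ordered partitions and their merges *)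

Fixpoint merges l :=
  if l is B :: l1 then
    (if l1 is C :: l2 then [:: (B :|: C) :: l2] else [::]) ++
    map (cons B) (merges l1)
  else [::].

(** The set [A] collects the blocks already read. *)
Fixpoint opartition A l :=
  if l is B :: l1 then
    [&& B != set0, [disjoint A & B] & opartition (A :|: B) l1]
  else A == setT.

Arguments opartition : simpl never.

Lemma opartition_cons A B l :
  opartition A (B :: l) =
    [&& B != set0, [disjoint A & B] & opartition (A :|: B) l].
Proof. by []. Qed.

Lemma disjoint_setUl A B C :
  [disjoint A :|: B & C] = [disjoint A & C] && [disjoint B & C].
Proof. by rewrite -!setI_eq0 setIUl setU_eq0. Qed.

Lemma disjoint_setUr A B C :
  [disjoint A & B :|: C] = [disjoint A & B] && [disjoint A & C].
Proof. by rewrite -!setI_eq0 setIUr setU_eq0. Qed.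

Lemma merges_spec l t : l \in merges t ->
  [/\ size t = (size l).+1, l != [::], first_max t <= first_max l &
      first_min l <= first_min t].
Proof.
elim: t l => [//|B t IHt] l /=;
  rewrite mem_cat => /orP[|/mapP[m /IHt[sz _ _ _] ->]].
  case: t {IHt} => // C t; rewrite inE => /eqP ->; split=> //=.
    by rewrite bmaxU; lia.
  by rewrite bminU; lia.
by split=> //=; rewrite sz.
Qed.

Lemma merges_descending l t : l \in merges t -> descending t -> descending l.
Proof.
elim: t l => [//|B t IHt] l /=; rewrite mem_cat descending_cons.
case/orP=> [|/mapP[m mt ->] /andP[h dt]].
  case: t {IHt} => // C t; rewrite inE => /eqP -> /andP[_].
  rewrite !descending_cons bmaxU => /andP[h ->]; rewrite andbT.
  by case/orP: h => [->//|h]; apply/orP; right; lia.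
rewrite descending_cons IHt // andbT; have [_ m0 _ le] := merges_spec mt.
by apply/orP; right; case: (t) h mt le => //= C t' h _ le; lia.
Qed.

Lemma merges_opartition A l t : l \in merges t -> opartition A t ->
  opartition A l.
Proof.
elim: t A l => [//|B t IHt] A l; rewrite [merges _]/= mem_cat.
case/orP=> [|/mapP[m mt ->]]; last first.
  by rewrite !opartition_cons => /and3P[-> -> /=]; exact: IHt.
case: t {IHt} => // C t; rewrite inE !opartition_cons => /eqP ->.
rewrite disjoint_setUl => /and5P[B0 dB C0 /andP[dC _] ot].
by rewrite opartition_cons setU_eq0 negb_and B0 disjoint_setUr dB dC setUA.
Qed.

Lemma toggle_merges lo hi l t : nonempty l -> toggle lo hi l = Some t ->
  l \in merges t \/ t \in merges l.
Proof.
elim: l lo hi t => [//|B l IHl] lo hi t; rewrite nonempty_cons => /andP[B0 l0].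
rewrite toggle_cons; case: ifP => [/and4P[_ lN0 _ _] [<-]|_].
  by right; case: l lN0 {IHl l0} => //= C l; rewrite inE eqxx.
case: ifP => [_ [<-]|_].
  by left; rewrite /= setU_topmost_rest inE eqxx.
case E: toggle => [m|//] [<-] /=; rewrite !mem_cat.
by case: (IHl _ _ _ l0 E) => h; [left|right]; apply/orP; right; apply: map_f.
Qed.

Lemma opartition_nonempty A l : opartition A l -> nonempty l.
Proof.
by elim: l A => //= B l IHl A /and3P[B0 _ /IHl]; rewrite nonempty_cons B0.
Qed.

Lemma opartition_toggle A lo hi l t : nonempty l -> toggle lo hi l = Some t ->
  opartition A l -> opartition A t.
Proof.
elim: l lo hi t A => [//|B l IHl] lo hi t A; rewrite nonempty_cons toggle_cons.
move=> /andP[B0 l0]; case: ifP => [/and4P[_ lN0 _ _] [<-]|_].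
  apply: merges_opartition; case: l lN0 {IHl l0} => //= C l.
  by rewrite inE eqxx.
case: ifP => [/and3P[r0 _ _] [<-]|_].
  rewrite !opartition_cons => /and3P[_ dB ol].
  rewrite topmost_neq0 // r0 -setUA setU_topmost_rest ol andbT disjoint_setUl.
  by rewrite topmost_disjoint andbT -disjoint_setUr setU_topmost_rest.
case E: toggle => [m|//] [<-]; rewrite !opartition_cons => /and3P[-> -> /=].
exact: IHl E.
Qed.

Arguments merges : simpl never.

Lemma merges_cons2 B C l :
  merges [:: B, C & l] = ((B :|: C) :: l) :: map (cons B) (merges (C :: l)).
Proof. by []. Qed.

(** * The potential *)

(** Each block contributes its maximum, then 0, 1 or 2 according to whether it
    has several elements and is not splittable, has several elements and is
    splittable, or is a singleton, and finally its size. Merging with a later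
    block raises the maximum or the size; a merge that lowers the minimum of the
    next block can only make a block splittable; and splitting turns a
    splittable block into a singleton with the same maximum. *)
Fixpoint potential lo hi l : seq nat :=
  if l is B :: l1 then
    [:: bmax B, (2 * (rest B == set0) + splittable hi B l1)%N, #|B| &
        potential (next_lo hi B) (next_hi lo B l1) l1]
  else [::].

Lemma potential_first_max lo hi lo' hi' l l' : l != [::] -> l' != [::] ->
  first_max l < first_max l' ->
  (potential lo hi l < potential lo' hi' l' :> seqlexi nat)%O.
Proof.
case: l l' => [//|B l] [//|C l'] _ _ /= h.
by rewrite ltxi_cons leEnat (ltnW h) /= leqNgt h.
Qed.

Lemma size_toggle_cons lo hi B l t :
  nonempty (B :: l) -> toggle lo hi (B :: l) = Some t -> size t = (size l).+2 ->
  ~~ mergeable lo B l /\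
  if splittable hi B l then t = topmost B :: rest B :: l
  else exists2 m, toggle (next_lo hi B) (next_hi lo B l) l = Some m &
                  t = B :: m /\ size m = (size l).+1.
Proof.
move=> ne; rewrite toggle_cons; case: ifP => [/and4P[_ lN0 _ _] [<-]|_] /=.
  by rewrite size_behead; lia.
case: ifP => [_ [<-]//|_]; case: toggle => [m|//] [<-] /= [sz].
by split=> //; exists m.
Qed.

(** Let [t] arise from [l] by a split at the block number i. A facet [l'] of [t]
    that keeps the new singleton has a larger entry at i, unless an earlier
    entry has grown. A facet that merges earlier blocks j and j+1 has a larger
    maximum or a larger size at j, except if block j is a singleton exceeding
    block j+1: such a merge was passed over because of [lo], and then block j-1
    of [l'] is splittable although it is not in [l]. The bound on [first_min l']
    expresses that no such growth occurs before the first block. *)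
Lemma potential_increasing lo hi A l t l' :
  nonempty l -> descending l -> admissible lo hi l -> opartition A t ->
  toggle lo hi l = Some t -> size t = (size l).+1 ->
  l' \in merges t -> l' != l -> lo <= first_min l' ->
  (potential lo hi l < potential lo hi l' :> seqlexi nat)%O.
Proof.
elim: l lo hi A t l' => [//|B l IHl] lo hi A t l' nel del adm ot tog sz.
have [nmg] := size_toggle_cons nel tog sz.
case: ifP => [sp te|/negbT nsp [m togm [te szm]]].
  rewrite {}te merges_cons2 inE setU_topmost_rest.
  case/predU1P=> [->|]; first by rewrite eqxx.
  (* The new singleton survives in [l'] and its entry 2 beats the 1 of [l]. *)
  case/mapP=> m _ -> _ _.
  have [B0 _] : B != set0 /\ nonempty l by apply/andP.
  have r0 : rest B != set0 by case/and3P: sp.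
  by rewrite /= !ltxi_cons bmax_topmost // lexx /= sp (negbTE r0) rest_topmost
    // eqxx.
move=> ml'.
have adn := admissible_next nel del adm nmg nsp.
have [B0 nel'] : B != set0 /\ nonempty l by apply/andP.
have del' : descending l.
  by move: del; rewrite descending_cons => /andP[].
have [nem dem admm _ [m0 mxm _]] := toggle_spec nel' del' adn togm.
case: m m0 => [//|H m] _ in te szm togm nem dem admm mxm ml' *.
have lN0 : l != [::] by case: (l) togm.
have mhi : first_min (H :: m) < next_hi lo B l \/ next_hi lo B l = 0.
  by move: admm => /= /andP[_]; case: eqP; [right|left].
move: ml' ot; rewrite {}te merges_cons2 inE !opartition_cons.
rewrite disjoint_setUl => ml' /and5P[_ _ H0 /andP[dAH dBH] om].
case/predU1P: ml' => [->|/mapP[m' mm' ->]] neq lo_le.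
  rewrite /= in mxm lo_le mhi.
  have [lt|ge] := ltnP (bmax B) (bmax H).
    by apply: potential_first_max => //; rewrite /= bmaxU leq_max lt orbT.
  have {}ge : bmax H < bmax B by rewrite ltn_neqAle eq_sym bmax_disjoint.
  have e : bmax (B :|: H) = bmax B by rewrite bmaxU; apply/maxn_idPl/ltnW.
  have [r0|r0] := eqVneq (rest B) set0.
    (* The merge was forbidden by [lo], so it violates the bound on [l']. *)
    move: nmg mhi lo_le; rewrite /mergeable /next_hi r0 eqxx lN0 -mxm ge bminU
      /=.
    by clear; have := bmin_gt0 H; lia.
  have szB : #|B| < #|B :|: H|.
    rewrite cardsU (_ : B :&: H = set0); last by apply/eqP; rewrite setI_eq0.
    by rewrite cards0 subn0 -{1}[#|B|]addn0 ltn_add2l card_gt0.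
  rewrite /= !ltxi_cons e lexx /= (negbTE r0) (negbTE nsp) /= !leEnat /=.
  by rewrite [#|B :|: H| <= _]leqNgt szB (ltnW szB) implybT.
have [_ m'0 mxle mnle] := merges_spec mm'.
have mne : m' != l.
  by apply: contra neq => /eqP ->.
rewrite /= !ltxi_cons lexx (negbTE nsp) !leEnat !leq_add2l leqnn /=.
(* If [B] becomes splittable in [l'] its entry grows from 0 to 1. *)
case: (boolP (splittable hi B m')) => //= nsp'.
have lo_m' : next_lo hi B <= first_min m'.
  move: nsp'; rewrite /splittable /next_lo; case: (rest B != set0) => //=.
  by case: (bmax B < hi) => //=; rewrite -leqNgt.
have otm : opartition (A :|: B) (H :: m) by rewrite opartition_cons H0
  disjoint_setUl dAH dBH.
have IH := IHl _ _ _ _ _ nel' del' adn otm togm szm mm' mne lo_m'.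
have [e|ne] := eqVneq (next_hi lo B m') (next_hi lo B l); first by rewrite e.
(* The scan continues with another bound only if the next maximum has grown. *)
apply: potential_first_max => //; rewrite -mxm; move: ne mxle;
  rewrite /next_hi -mxm /=.
by case: (rest B != set0); [rewrite eqxx | clear; do 2!case: ifP; lia].
Qed.

(** * Counting blocks of unmatched partitions *)

Definition singles l := count (fun B => rest B == set0) l.

(** If S blocks are singletons and N are larger, the inequality reads S <= N +
    c. The allowance c is 0 when a preceding singleton is charged to the first
    block, 2 when the preceding block is still free to be charged for a merge
    forbidden by [lo], and 1 otherwise. *)
Lemma singles_critical lo hi l :
  nonempty l -> descending l -> admissible lo hi l -> toggle lo hi l = None ->
  2 * singles l <= size l + ((hi != 0) + (hi != 0) * (lo != 0)).
Proof.
elim: l lo hi => [//|B l IHl] lo hi nel del adm.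
have adn := admissible_next nel del adm; move: adm => /= /andP[_ a2].
rewrite toggle_cons; case: ifP => // /negbT nmg; case: ifP => // /negbT nsp.
case E: toggle => [//|] _.
have [B0 nel'] : B != set0 /\ nonempty l by apply/andP.
have del' : descending l by move: del; rewrite descending_cons => /andP[].
have := IHl _ _ nel' del' (adn nmg nsp) E; rewrite /singles /=.
have [r0|r0] := eqVneq (rest B) set0.
  move: nmg a2; rewrite /mergeable /next_hi /next_lo r0 eqxx /= (rest0_bmin B0
    r0).
  case: (l) => [|C l'] /=; first by clear; case: ifP; lia.
  by clear; do ?case: ifP; lia.
move: a2; rewrite /next_hi /next_lo r0 /=; have := bmax_gt0 B0.
by clear; do ?case: ifP; lia.
Qed.

Lemma opartition_card A l : opartition A l -> #|A| + \sum_(B <- l) #|B| = n.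
Proof.
elim: l A => [|B l IHl] A; first by move=> /eqP ->;
  rewrite big_nil cardsT card_ord addn0.
rewrite opartition_cons big_cons => /and3P[_ dAB /IHl]; rewrite cardsU.
by rewrite (_ : A :&: B = set0) ?cards0 ?subn0 ?addnA //; apply/eqP;
  rewrite setI_eq0.
Qed.

Lemma size_singles l : nonempty l ->
  2 * size l <= \sum_(B <- l) #|B| + singles l.
Proof.
elim: l => [//|B l IHl]; rewrite nonempty_cons => /andP[B0 /IHl];
  rewrite big_cons /=.
have -> : #|B| = #|topmost B| + #|rest B|.
  rewrite -{1}(setU_topmost_rest B) cardsU (_ : _ :&: _ = set0) ?cards0 ?subn0
    //.
  by apply/eqP; rewrite setI_eq0 topmost_disjoint.
have := topmost_neq0 B0; rewrite -!card_gt0 -cards_eq0; set a := #|topmost B|;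
  set b := #|rest B|.
by rewrite /singles /=; case: eqP; lia.
Qed.

Lemma critical_size hi l : opartition set0 l -> descending l ->
  admissible 0 hi l ->
  toggle 0 hi l = None -> 3 * size l <= 2 * n + 1.
Proof.
move=> ol del adm tog; have nel := opartition_nonempty ol.
have := singles_critical nel del adm tog; have := size_singles nel.
by have := opartition_card ol; rewrite cards0; case: (hi != 0); lia.
Qed.

(** * Faces of the h-complex as ordered partitions *)

(** The partial unions of the blocks, without the last one, which is the whole
    ground set. *)
Fixpoint face A l : {set {set 'I_n}} :=
  if l is B :: l1 then
    (if l1 is [::] then set0 else [set A :|: B]) :|: face (A :|: B) l1
  else set0.

Lemma face1 A B : face A [:: B] = set0.
Proof. by rewrite /= setU0. Qed.

Lemma face_cons A B l : l != [::] ->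
  face A (B :: l) = (A :|: B) |: face (A :|: B) l.
Proof. by case: l. Qed.

Lemma face_merge A B C l : face A ((B :|: C) :: l) = face (A :|: B) (C :: l).
Proof. by rewrite /= setUA. Qed.

Lemma proper_setU A B : B != set0 -> [disjoint A & B] -> A \proper A :|: B.
Proof.
case/set0Pn => x xB dAB; apply/properP; split; first exact: subsetUl.
by exists x; rewrite ?inE ?xB ?orbT // (disjointFl dAB).
Qed.

Lemma face_proper A l X : opartition A l -> X \in face A l -> A \proper X.
Proof.
elim: l A => [|B l IHl] A; first by rewrite inE.
rewrite opartition_cons => /and3P[B0 dAB ol].
have [->|l0] := eqVneq l [::]; first by rewrite face1 inE.
rewrite face_cons // => /setU1P[->|/(IHl _ ol)]; first exact: proper_setU.
exact/proper_trans/proper_setU.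
Qed.

Lemma face_notin A l : opartition A l -> A \notin face A l.
Proof. by move=> ol; apply/negP => /(face_proper ol); rewrite properxx. Qed.

Lemma card_face A l : l != [::] -> opartition A l -> size l = #|face A l|.+1.
Proof.
elim: l A => [//|B l IHl] A _; rewrite opartition_cons => /and3P[B0 dAB ol].
have [->|l0] := eqVneq l [::]; first by rewrite face1 cards0.
by rewrite face_cons // cardsU1 face_notin //= (IHl (A :|: B)).
Qed.

Lemma face_merges A t l : opartition A t -> l \in merges t ->
  exists2 v, v \in face A t & face A l = face A t :\ v.
Proof.
elim: t A l => [//|B [//|C t] IHt] A l;
  rewrite opartition_cons => /and3P[B0 dAB ot].
rewrite merges_cons2 face_cons // => /predU1P[->|/mapP[m ml ->]].
  exists (A :|: B); first exact: setU11.
  by rewrite setU1K ?face_notin // face_merge.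
have [v vt e] := IHt _ _ ot ml; exists v; first by rewrite inE vt orbT.
have [_ m0 _ _] := merges_spec ml; rewrite face_cons // e.
apply/setP => X; rewrite !inE; case: (eqVneq X (A :|: B)) => //= ->.
by apply/esym; rewrite andbT; apply: contraTneq vt => <-; exact: face_notin.
Qed.

Lemma face_facet A t v : opartition A t -> v \in face A t ->
  exists2 l, l \in merges t & face A l = face A t :\ v.
Proof.
elim: t A => [|B t IHt] A; first by rewrite inE.
rewrite opartition_cons => /and3P[B0 dAB ot].
case: t IHt ot => [|C t] IHt ot; first by rewrite face1 inE.
rewrite merges_cons2 face_cons // => /setU1P[->|vt].
  exists ((B :|: C) :: t); first by rewrite inE eqxx.
  by rewrite setU1K ?face_notin // face_merge.
have [l lm e] := IHt _ ot vt; have [_ l0 _ _] := merges_spec lm.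
exists (B :: l); first by rewrite inE map_f ?orbT.
rewrite face_cons // e; apply/setP => X; rewrite !inE.
case: (eqVneq X (A :|: B)) => //= ->.
by apply/esym; rewrite andbT; apply: contraTneq vt => <-; exact: face_notin.
Qed.

Lemma disjoint_setU_inj A B B' : [disjoint A & B] -> [disjoint A & B'] ->
  A :|: B = A :|: B' -> B = B'.
Proof.
have K C : [disjoint A & C] -> (A :|: C) :\: A = C.
  by move=> d; rewrite setDUl setDv set0U; apply/setDidPl; rewrite disjoint_sym.
by move=> /K {2}<- /K {2}<- ->.
Qed.

(** If there are at least two blocks, the first one is the smallest member of
    the face, minus [A]. *)
Lemma face_inj A l l' : opartition A l -> opartition A l' ->
  face A l = face A l' -> l = l'.
Proof.
have nil_cons B A' m : opartition A' [::] -> opartition A' (B :: m) -> False.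
  rewrite opartition_cons => /eqP -> /and3P[/set0Pn[x xB] d _].
  by have := disjointFl d xB; rewrite inE.
elim: l l' A => [|B l IHl] [|B' l'] A //.
- by move=> h h'; case: (nil_cons _ _ _ h h').
- by move=> h h'; case: (nil_cons _ _ _ h' h).
move=> ol ol'; have [l0|l0] := eqVneq l [::].
  have [l0'|l0'] := eqVneq l' [::].
    move: ol ol'; rewrite l0 l0' !opartition_cons => /and3P[_ d /eqP e]
      /and3P[_ d' /eqP e'] _.
    by congr [:: _]; apply: disjoint_setU_inj d d' _; rewrite e e'.
  by rewrite l0 face1 face_cons // => /setP/(_ (A :|: B')); rewrite !inE eqxx.
have [l0'|l0'] := eqVneq l' [::].
  by rewrite l0' face1 face_cons // => /setP/(_ (A :|: B)); rewrite !inE eqxx.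
move: ol ol'; rewrite !opartition_cons !face_cons // => /and3P[B0 d o]
  /and3P[B0' d' o'] e.
have sub C D m k : opartition (A :|: C) m ->
  (A :|: D) |: k = (A :|: C) |: face (A :|: C) m ->
   A :|: C \subset A :|: D.
  move=> om /setP/(_ (A :|: D)); rewrite !inE eqxx => /esym/orP[/eqP->//|].
  by move/(face_proper om)/proper_sub.
have eU : A :|: B = A :|: B'.
  by apply/eqP; rewrite eqEsubset (sub _ _ _ _ o' e) (sub _ _ _ _ o (esym e)).
have eB : B = B' by exact: disjoint_setU_inj d d' eU.
rewrite -eB; congr cons; apply: (IHl _ (A :|: B)) => //; first by rewrite eU.
move: e; rewrite -eU => e.
by rewrite -(setU1K (face_notin o)) e setU1K // face_notin // eU.
Qed.

Definition starts_below w x := if w is y :: _ then y < x else false.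

(** A version of [sigma] by recursion on words, where [A] collects the letters
    already read. *)
Fixpoint descent_sets A w : {set {set 'I_n}} :=
  if w is x :: w1 then
    (if starts_below w1 x then [set x |: A] else set0) :|: descent_sets (x |:
      A) w1
  else set0.

Lemma descent_setsP A w X : reflect
  (exists i (x y : 'I_n),
     [/\ i.+1 < size w, nth y w i = x, nth x w i.+1 = y, y < x &
     X = A :|: [set z in take i.+1 w]])
  (X \in descent_sets A w).
Proof.
elim: w A => [|x w IHw] A.
  by rewrite inE; constructor; case=> i [x [y []]]; rewrite ltn0.
apply: (iffP idP) => [/= /setUP[]|].
- case: w {IHw} => [|y w] /=; first by rewrite inE.
  case: ifP => yx; rewrite inE // => /eqP ->; exists 0, x, y; split=> //.
  by apply/setP => z; rewrite !inE orbC.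
- case/IHw=> i [a [b [si na nb ba ->]]]; exists i.+1, a, b; split=> //.
  apply/setP => z; rewrite !inE; case: (z == x); case: (z \in A) => //=;
    rewrite ?orbT //.
case=> -[|i] [a [b [si na nb ba eX]]] /=; rewrite inE.
  case: w si na nb eX {IHw} => [//|c w] _ /= xa cb eX.
  rewrite -xa -cb in ba; rewrite ba inE; apply/orP; left; apply/eqP; rewrite eX.
  by apply/setP => z; rewrite !inE orbC.
apply/orP; right; apply/IHw; exists i, a, b; split=> //.
by rewrite eX; apply/setP => z; rewrite !inE; case: (z == x); case: (z \in A).
Qed.

Lemma sigma_descent_sets (s : 'S_n) :
  sigma s = descent_sets set0 (map s (enum 'I_n)).
Proof.
have nthE (z : 'I_n) (i : 'I_n) : nth z (map s (enum 'I_n)) i = s i.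
  by rewrite (nth_map i) ?size_enum_ord // nth_ord_enum.
have preE (i : 'I_n) : prefix_set s i = set0 :|: [set z in take i.+1 (map s
  (enum 'I_n))].
  apply/setP => z; rewrite set0U inE -map_take; apply/imsetP/mapP => -[j].
    rewrite inE => ji ->; exists j => //.
    rewrite in_take ?mem_enum // index_enum_ord. exact: ji.
  rewrite in_take ?mem_enum // index_enum_ord => ji ->; exists j => //.
  by rewrite inE.
apply/setP => X; apply/imsetP/descent_setsP => [[i]|[i [x [y [si ix iy yx
  ->]]]]].
  rewrite inE => /existsP[j /andP[/eqP ji sji] ->].
  exists i, (s i), (s j); rewrite size_map size_enum_ord -ji; split=> //.
by rewrite preE ji.
rewrite size_map size_enum_ord in si.
pose i' := Ordinal (ltnW si); pose j' := Ordinal si.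
exists i'; last by rewrite preE.
rewrite inE; apply/existsP; exists j'; rewrite eqxx /=.
by rewrite -(nthE y i') -(nthE x j') /= ix iy.
Qed.

(** The blocks are the ascending runs: a letter below its successor joins the
    first block of what follows, any other letter forms a block of its own. *)
Lemma blocks_of_word A w : w != [::] -> uniq w -> [disjoint A & w] ->
  A :|: [set z in w] = setT ->
  exists2 l, [/\ opartition A l, descending l & descent_sets A w = face A l] &
    forall x, ohead w = Some x -> if l is B :: _ then x \in B else false.
Proof.
elim: w A => [//|x w IHw] A _ /= /andP[xw uw].
rewrite disjoint_sym disjoint_cons => /andP[xA dwA] eT.
have [w0|w0] := eqVneq w [::].
  exists [:: [set x]] => [|_ [<-]]; last by rewrite inE.
  rewrite w0 /= !setU0; split=> //; rewrite !opartition_cons.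
  rewrite disjoint_sym disjoints1 xA; apply/andP; split.
    by apply/set0Pn; exists x; rewrite inE.
  by rewrite /opartition -eT w0; apply/eqP/setP => z; rewrite !inE.
have [||l [ol dl el] hl] := IHw (x |: A) w0 uw.
  apply/pred0P => z; rewrite /= !inE; case: eqP => [->|_] /=;
    first exact: negbTE.
  by have /pred0P/(_ z) := dwA; rewrite /= andbC.
  by rewrite -eT; apply/setP => z; rewrite !inE; case: (z == x);
    case: (z \in A).
case: w w0 xw uw dwA eT IHw el hl => [//|y w] _ xw uw dwA eT _ el hl.
have {hl} := hl y erefl.
case: l ol dl el => [//|B l] ol dl el yB.
have xB : x \notin B.
  by move: ol; rewrite opartition_cons => /and3P[_ /disjointFr/(_ (setU11 x A))
    ->].
move: ol; rewrite opartition_cons disjoint_setUl => /and3P[B0 /andP[dxB dAB]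
  ol].
case: ifP => [yx|nyx].
  exists [:: [set x], B & l] => [|_ [<-]]; last by rewrite inE.
  rewrite !opartition_cons; split.
  - rewrite disjoint_sym disjoints1 xA B0 [A :|: [set x]]setUC disjoint_setUl
    dxB dAB ol !andbT.
    by apply/set0Pn; exists x; rewrite inE.
  - rewrite descending_cons dl andbT /=; apply/leq_ltn_trans/mem_bmax/set11.
    exact: leq_trans (mem_bmin yB) yx.
  - by rewrite face_cons // el [A :|: _]setUC.
exists ((x |: B) :: l) => [|_ [<-]]; last exact: setU11.
split.
- rewrite opartition_cons disjoint_setUr dAB disjoint_sym disjoints1 xA.
  rewrite setUA [A :|: _]setUC ol !andbT.
  by apply/set0Pn; exists x; rewrite setU11.
- move: dl; rewrite !descending_cons bmaxU => /andP[h ->]; rewrite andbT.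
  by case/orP: h => [->//|h]; rewrite leq_max h !orbT.
- by rewrite set0U face_merge [A :|: _]setUC.
Qed.

(** Write each block in increasing order. The induction removes one letter, the
    minimum of the first block, which does not change the maximum of the block
    unless this was a singleton. *)
Lemma word_of_blocks A l : l != [::] -> opartition A l -> descending l ->
  exists2 w, [/\ uniq w, w =i ~: A & descent_sets A w = face A l] &
    exists2 x, ohead w = Some x & x.+1 = first_min l.
Proof.
have [N] := ubnP #|~: A|; elim: N A l => // N IHN A [//|B l] szA _.
rewrite opartition_cons descending_cons => /and3P[B0 dAB ol] /andP[hd dl].
have [x xB mnB] := bmin_mem B0.
have xA : x \notin A by rewrite (disjointFl dAB xB).
have szxA : #|~: (x |: A)| < N.
  have: ~: (x |: A) \proper ~: A.
    rewrite properC properEneq subsetU1 andbT.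
    by apply: contraNneq xA => ->; exact: setU11.
  by move/proper_card; lia.
have [B1|B1] := eqVneq (B :\ x) set0.
  have {B1}eB : B = [set x].
    by apply/eqP; rewrite eqEsubset sub1set xB andbT -setD_eq0 B1.
  have [l0|l0] := eqVneq l [::].
    exists [:: x]; last by exists x.
    split=> //; last by rewrite l0 face1 /= setU0.
    by move: ol; rewrite l0 /opartition => /eqP/setP eT z; move: (eT z) xA;
       rewrite !inE eB inE; case: eqP => [-> _ ->|_ /=]; [|rewrite orbF => ->].
  have eAB : A :|: B = x |: A by rewrite eB setUC.
  rewrite eAB in ol; have [w [uw ew dw] [y hw mny]] := IHN _ _ szxA l0 ol dl.
  exists (x :: w); last by exists x.
  split.
  - by rewrite /= uw ew !inE eqxx.
  - by move=> z; rewrite !inE ew !inE negb_or; case: eqP => [->|].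
  - rewrite face_cons // eAB /= dw; congr (_ :|: _).
    case: w hw {uw ew dw} => [//|c w] [->] /=.
    move: hd; rewrite (negbTE l0) /= -mny eB /bmax big_set1 ltnS => -> //.
have eB : B = x |: B :\ x by rewrite setD1K.
have oB : opartition (x |: A) (B :\ x :: l).
  rewrite opartition_cons B1 disjoint_setUl disjoints1 !inE eqxx /=.
  rewrite (disjointWr _ dAB) ?subD1set //=.
  by rewrite [x |: A]setUC -setUA setD1K.
have lt : x.+1 < bmin (B :\ x).
  have [z] := bmin_mem B1; rewrite !inE => /andP[zx zB] ->.
  by rewrite ltn_neqAle -mnB mem_bmin // mnB eqSS eq_sym (inj_eq val_inj) zx.
have dB : descending (B :\ x :: l).
  rewrite descending_cons dl andbT; case/orP: hd => [->//|].
  rewrite {1}eB bmaxU {1}/bmax big_set1 => h; apply/orP; right.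
  by clear -lt h B1; have := bmin_le_bmax B1; lia.
have [w [uw ew dw] [y hw mny]] := IHN _ (_ :: _) szxA isT oB dB.
exists (x :: w); last by exists x.
split.
- by rewrite /= uw ew !inE eqxx.
- by move=> z; rewrite !inE ew !inE negb_or; case: eqP => [->|].
- rewrite eB face_merge [A :|: _]setUC /= dw.
  case: w hw {uw ew dw} => [//|c w] [->] /=.
  by move: lt; rewrite -[bmin _]mny ltnS => /ltnW; rewrite leqNgt => /negbTE
    ->; rewrite set0U.
Qed.

Lemma h_complexP (X : {set {set 'I_n}}) : 0 < n -> reflect
  (exists2 l, opartition set0 l /\ descending l & face set0 l = X)
  (X \in h_complex n).
Proof.
move=> n0; apply: (iffP imsetP) => [[s _ ->]|[l [ol dl <-]]].
  rewrite sigma_descent_sets.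
  have [||||l [ol dl ->] _] := @blocks_of_word set0 (map s (enum 'I_n)).
  - by rewrite -size_eq0 size_map size_enum_ord -lt0n.
  - by rewrite map_inj_uniq ?enum_uniq //; exact: perm_inj.
  - by apply/pred0P => z; rewrite /= inE.
  - apply/setP => z; rewrite !inE; apply/mapP.
    by exists (s^-1 z)%g; rewrite ?mem_enum ?permKV.
  by exists l.
have l0 : l != [::].
  apply: contraTneq ol => ->; rewrite /opartition eq_sym -subset0.
  by apply/subsetPn; exists (Ordinal n0); rewrite inE.
have [w [uw ew <-] _] := word_of_blocks l0 ol dl.
have sw : size w = n.
  rewrite -(card_uniqP uw) -[RHS](card_ord n); apply: eq_card => z.
  by rewrite ew !inE.
have inj : injective (fun i : 'I_n => nth i w i).
  move=> i j; rewrite (set_nth_default j) ?sw // => /eqP.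
  by rewrite nth_uniq ?sw // => /eqP/val_inj.
exists (perm inj) => //; rewrite sigma_descent_sets; congr descent_sets.
apply: (@eq_from_nth _ (Ordinal n0)) => [|i];
  first by rewrite size_map size_enum_ord sw.
rewrite sw => i_n; rewrite (nth_map (Ordinal i_n)) ?size_enum_ord // permE.
by rewrite nth_enum_ord //; apply: set_nth_default; rewrite sw.
Qed.

(** * The matching on the h-complex *)

Hypothesis n_gt0 : 0 < n.

Definition toggle_pairs : {set {set {set 'I_n}} * {set {set 'I_n}}} :=
  [set p | `[< exists l t, [/\ opartition set0 l, descending l,
                 toggle 0 n.+1 l = Some t, size t = (size l).+1 &
                 p = (face set0 l, face set0 t)] >]].

Let toggle_pairsP E F : (E, F) \in toggle_pairs -> exists l u,
  [/\ opartition set0 l, descending l, toggle 0 n.+1 l = Some u,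
      size u = (size l).+1 & E = face set0 l /\ F = face set0 u].
Proof.
by rewrite inE => /asboolP[l [u [ol dl e sz [-> ->]]]]; exists l, u.
Qed.

(** The initial value [n.+1] of [hi] exceeds all elements, since nothing
    precedes the first block. *)
Lemma opartition_admissible l : opartition set0 l -> admissible 0 n.+1 l.
Proof.
case: l => // B l; rewrite opartition_cons => /and3P[B0 _ _] /=.
by rewrite ltnS (leq_trans (bmin_le_bmax B0)) ?bmax_le_n.
Qed.

Lemma toggle_opartition l t : opartition set0 l -> descending l ->
  toggle 0 n.+1 l = Some t ->
  [/\ opartition set0 t, descending t & toggle 0 n.+1 t = Some l].
Proof.
move=> ol dl e; have nel := opartition_nonempty ol.
have [_ dt _ e' _] := toggle_spec nel dl (opartition_admissible ol) e.
by split=> //; exact: opartition_toggle e ol.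
Qed.

Lemma toggle_size l t : opartition set0 l -> toggle 0 n.+1 l = Some t ->
  size t = (size l).+1 /\ l \in merges t \/
  size l = (size t).+1 /\ t \in merges l.
Proof.
move=> ol /(toggle_merges (opartition_nonempty ol))[] h;
  have [e _ _ _] := merges_spec h;
  by [left|right].
Qed.

Lemma h_complex_del E v : E \in h_complex n -> E :\ v \in h_complex n.
Proof.
move=> ED; have [vE|vE] := boolP (v \in E); last first.
  by rewrite (setDidPl _) // disjoint_sym disjoints1.
move: ED vE => /(h_complexP _ n_gt0)[t [ot dt] <-] /(face_facet ot)[l lt <-].
apply/(h_complexP _ n_gt0); exists l => //; split.
  exact: merges_opartition lt ot.
exact: merges_descending lt dt.
Qed.

Lemma toggle_matching : matching (h_complex n) toggle_pairs.
Proof.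
split=> [[s t]|[s t] [s' t']].
  move=> /toggle_pairsP[l [u [ol dl e sz [-> ->]]]] /=.
  have [ou du _] := toggle_opartition ol dl e.
  apply/(coversP h_complex_del); split.
    by apply/(h_complexP _ n_gt0); exists u.
  have [[_ lu]|[sz' _]] := toggle_size ol e; last by lia.
  exact: face_merges lu.
move=> /toggle_pairsP[l [u [ol dl e sz [->
  ->]]]] /toggle_pairsP[l' [u' [ol' dl' e' sz' [-> ->]]]] neq.
have [ou du eu] := toggle_opartition ol dl e;
  have [ou' du' eu'] := toggle_opartition ol' dl' e'.
apply/pred0P => E; rewrite /= !inE; apply/negP => /andP[].
have contra_pair : l = l' \/ u = u' -> False.
  case=> h; move: neq; first by move: e'; rewrite -h e => -[->]; rewrite eqxx.
  by move: eu'; rewrite -h eu => -[->]; rewrite eqxx.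
case/orP=> /eqP -> /orP[]/eqP h.
- by apply: contra_pair; left; exact: face_inj h.
- by have := face_inj ol ou' h => h'; move: eu'; rewrite -h' e => -[?]; subst;
  lia.
- by have := face_inj ou ol' h => h'; move: e'; rewrite -h' eu => -[?]; subst;
  lia.
- by apply: contra_pair; right; exact: face_inj h.
Qed.

Lemma toggle_acyclic : acyclic (h_complex n) toggle_pairs.
Proof.
have [blocks blocksK] : exists f : {set {set 'I_n}} -> seq {set 'I_n},
    forall l, opartition set0 l -> f (face set0 l) = l.
  exists (fun E => if pselect (exists l,
    opartition set0 l /\ face set0 l = E) is left h
                   then projT1 (cid h) else [::]) => l ol.
  case: pselect => [h|[]]; last by exists l.
  by case: (cid h) => l' /= [ol' /face_inj]; exact.
apply: (acyclic_of_rank h_complex_del toggle_matching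
  (phi := fun E => potential 0 n.+1 (blocks E) : seqlexi nat)) => s t s'.
move=> /toggle_pairsP[l [u [ol dl e sz [->
  ->]]]] /(coversP h_complex_del)[_ [v vu ->]] neq.
have [ou du _] := toggle_opartition ol dl e.
have [l' l'u e'] := face_facet ou vu; rewrite -e' !blocksK //;
  last exact: merges_opartition l'u ou.
apply: potential_increasing ou e sz l'u _ _ => //.
- exact: opartition_nonempty ol.
- exact: opartition_admissible.
- by apply: contraNneq neq => <-; rewrite e'.
Qed.

Lemma critical_card s : critical (h_complex n) toggle_pairs s ->
  3 * #|s| + 2 <= 2 * n.
Proof.
case/andP=> /(h_complexP _ n_gt0)[l [ol dl] <-] /forallP unmatched.
have l0 : l != [::].
  apply: contraTneq ol => ->; rewrite /opartition eq_sym -subset0.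
  by apply/subsetPn; exists (Ordinal n_gt0); rewrite inE.
have sz := card_face l0 ol.
case e: (toggle 0 n.+1 l) => [t|]; last first.
  by have := critical_size ol dl (opartition_admissible ol) e; lia.
have [ot dt e'] := toggle_opartition ol dl e.
have [[szt _]|[szl _]] := toggle_size ol e.
  have := unmatched (face set0 l, face set0 t);
    rewrite !inE eqxx implybF => /negP[].
  by apply/asboolP; exists l, t.
have := unmatched (face set0 t, face set0 l);
  rewrite !inE eqxx orbT implybF => /negP[].
by apply/asboolP; exists t, l.
Qed.

End OrderedPartitions.

Local Open Scope ring_scope.

Theorem theorem6p2 (n : nat) (hn : (1 <= n)%N) :
  (exists M : {set {set {set 'I_n}} * {set {set 'I_n}}},
     acyclic_matching (h_complex n) M /\
     forall i : int, (2 * n%:R - 5) / 3 < i%:~R :> rat ->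
       forall s : {set {set 'I_n}},
         critical (h_complex n) M s -> face_dim s <> i) /\
  (forall i : int, (2 * n%:R - 5) / 3 < i%:~R :> rat ->
     forall x : reduced_homology (h_complex n) i, x = 0).
Proof.
have ncrit i : (2 * n%:R - 5) / 3 < i%:~R :> rat ->
    forall s, critical (h_complex n) (toggle_pairs n) s -> face_dim s <> i.
  rewrite ltr_pdivrMr // => lti s /(critical_card hn) card_s dim_s.
  have {lti} : (2 * n%:Z - 5)%:~R < (i * 3)%:~R :> rat.
    by rewrite rmorphB !rmorphM.
  by rewrite ltr_int -dim_s /face_dim; lia.
have acyc : acyclic_matching (h_complex n) (toggle_pairs n).
  by split; [exact: toggle_matching | exact: toggle_acyclic].
split; first by exists (toggle_pairs n).
move=> i /ncrit; exact: (reduced_homology_eq0 (h_complex_del hn) acyc).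
Qed.
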